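(* Let $m,n\ge 3$ be integers with $mn$ even and let $l=\operatorname{lcm}(m,n)$. Then for every positive divisor $\alpha$ of $mn$ with $\alpha\equiv 0\pmod{l/2}$ and every Abelian group $\mathcal{A}$ of order $mn/\alpha$, the Cartesian product $C_m\square C_n$ has a $\mathbb{Z}_\alpha\times\mathcal{A}$-distance magic labeling.
   Context: $C_k$ denotes the cycle on $k\ge 3$ vertices. The Cartesian product $G\square H$ of graphs $G,H$ has vertex set $V(G)\times V(H)$; $(g,h)$ and $(g',h')$ are adjacent iff either $g=g'$ and $h$ is adjacent to $h'$ in $H$, or $h=h'$ and $g$ is adjacent to $g'$ in $G$. For a finite simple graph $G=(V,E)$ and an Abelian group $\Gamma$ (written additively) with $|\Gamma|=|V|$, a $\Gamma$-distance magic labeling of $G$ is a bijection $\ell\colon V\to\Gamma$ for which there exists $\mu\in\Gamma$ such that $\sum_{u\in N(v)}\ell(u)=\mu$ for every $v\in V$, where $N(v)$ is the open neighborhood of $v$. *)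

(* Defs.v *)
From HB Require Import structures.
From mathcomp Require Import all_boot all_order all_algebra.
Set Implicit Arguments.
Unset Strict Implicit.
Unset Printing Implicit Defensive.

Record sgraph := SGraph {
  vertex : finType;
  adj : rel vertex;
  adj_sym : symmetric adj;
  adj_irr : irreflexive adj
}.

Definition open_nbhd (G : sgraph) (v : vertex G) : {set vertex G} :=
  [set u | adj v u].

Section CycleGraph.
Variables (k : nat) (k_ge3 : 3 <= k).

(* [ordS] is the successor modulo k. *)
Definition cycle_adj : rel 'I_k := fun i j => (j == ordS i) || (i == ordS j).

Lemma cycle_adj_sym : symmetric cycle_adj.
Proof. by move=> i j; rewrite /cycle_adj orbC. Qed.

Lemma cycle_adj_irr : irreflexive cycle_adj.
Proof.
move=> i; rewrite /cycle_adj orbb; apply/negbTE/eqP => /(congr1 val) /=.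
have := ltn_ord i; rewrite leq_eqVlt => /orP[/eqP ik|ik].
  by rewrite ik modnn => i0; move: k_ge3; rewrite -ik i0.
by rewrite modn_small // => /eqP; rewrite ltn_eqF.
Qed.

Definition cycle_graph : sgraph := SGraph cycle_adj_sym cycle_adj_irr.
End CycleGraph.

Section CartesianProduct.
Variables G H : sgraph.

Definition cart_adj : rel (vertex G * vertex H)%type := fun x y =>
  ((x.1 == y.1) && adj x.2 y.2) || ((x.2 == y.2) && adj x.1 y.1).

Lemma cart_adj_sym : symmetric cart_adj.
Proof.
move=> x y; rewrite /cart_adj (eq_sym x.1) (eq_sym x.2).
by rewrite (adj_sym x.1) (adj_sym x.2).
Qed.

Lemma cart_adj_irr : irreflexive cart_adj.
Proof. by move=> x; rewrite /cart_adj !adj_irr !andbF. Qed.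

Definition cart_prod : sgraph := SGraph cart_adj_sym cart_adj_irr.
End CartesianProduct.

(* [A] may be any abelian group: bijectivity from the finite vertex set
   forces [A] to be finite, with as many elements as [G] has vertices. *)
Definition distance_magic_labeling (G : sgraph) (A : zmodType)
    (f : vertex G -> A) : Prop :=
  bijective f /\
  exists mu : A, forall v : vertex G, (\sum_(u in open_nbhd v) f u = mu)%R.

Definition has_distance_magic_labeling (G : sgraph) (A : zmodType) : Prop :=
  exists f : vertex G -> A, distance_magic_labeling f.

(* Main.v *)
(** Write [l = lcm m n], [h = l / 2], and let [beta] be an element of order
    [h].  The [gcd m n] orbits of the shift [(i, j) |-> (i + 1, j + 1)] on the
    torus have length [l].  Label the successive vertices of the [k]-th orbit by
    [a_k, c - a_k, a_k + beta, c - a_k - beta, a_k + 2 beta, ...]: consecutive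
    labels sum alternately to [c] and [c + beta], and the pattern closes up
    since [h beta = 0].  The neighbours [(i-1,j)], [(i,j+1)] are consecutive on
    an orbit, as are [(i,j-1)], [(i+1,j)], and when [m] is even these two pairs
    have opposite parities, so every neighbourhood sums to [2c + beta].  The
    labels are distinct as soon as the cosets [a_k + <beta>] and
    [c - a_k + <beta>] are; as the quotient by [<beta>] has even order
    [2 gcd m n], doubling is not onto there, so [c] can be chosen with
    [x |-> c - x] free of fixed points on the quotient, and the [a_k] form a
    transversal of its orbits. *)

Require Import Defs.
From mathcomp Require Import all_boot all_order all_algebra.
From mathcomp Require Import all_fingroup all_solvable.
Import GRing.Theory.
Set Implicit Arguments.
Unset Strict Implicit.
Unset Printing Implicit Defensive.

(** * Fixed-point-free involutions and reflections *)

(** In each orbit of [s], keep the element of smaller [enum_rank]. These form a set [S] that [s]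
    exchanges with its complement, so [S] has [d] elements. *)
Lemma involution_transversal (T : finType) (d : nat) (s : T -> T) :
    #|T| = d.*2 -> involutive s -> (forall y, s y <> y) ->
  exists a : 'I_d -> T, injective a /\ forall k k', a k <> s (a k').
Proof.
move=> cardT sK sfix.
pose S := [set y | enum_rank y < enum_rank (s y)].
have memC y : (s y \in S) = (y \notin S).
  rewrite !inE sK -leqNgt [RHS]leq_eqVlt; case: eqP => // e.
  by case: (sfix y); apply: enum_rank_inj; apply: val_inj.
have cardS : #|S| = d.
  have: #|S| + #|~: S| = d.*2 by rewrite cardsC.
  suff -> : ~: S = s @: S.
    by rewrite card_imset ?addnn; [move/double_inj | apply: inv_inj].
  apply/setP=> y; rewrite -{2}[y]sK (mem_imset _ _ (inv_inj sK)).
  by rewrite memC inE.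
exists (fun k => enum_val (cast_ord (esym cardS) k)); split.
  by move=> k k' /enum_val_inj/cast_ord_inj.
move=> k k' e; have := enum_valP (cast_ord (esym cardS) k).
by rewrite e memC enum_valP.
Qed.

Lemma even_card_double_not_onto (U : finZmodType) :
  ~~ odd #|U| -> exists c : U, forall x, (c - x)%R <> x.
Proof.
move=> ev.
have [] : {x : U | x \in [set: U] & #[x]%g = 2}.
  by apply: Cauchy; rewrite // cardsT dvdn2.
move=> x _ ox.
have xx : (x + x)%R = 0%R :> U by rewrite -mulr2n -FinRing.zmodXgE -ox expg_order.
have x0 : x <> 0%R :> U.
  by move=> x0; move: ox; rewrite x0 -FinRing.zmod1gE order1.
case: (pickP (fun c : U => [forall y, (c - y != y)%R])) => [c /forallP fc|onto].
  by exists c => y /eqP; apply/negP/fc.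
have dbl c : exists y : U, (y + y == c)%R.
  have /negbT := onto c; rewrite negb_forall => /existsP[y]; rewrite negbK.
  by move=> /eqP e; exists y; rewrite -{1}e subrK.
(* A section of doubling is injective, hence bijective by finiteness. Doubling is then its inverse
   and injective, yet it sends both [x] and 0 to 0. *)
pose g c := xchoose (dbl c).
have gK c : (g c + g c)%R = c by apply/eqP/(xchooseP (dbl c)).
have /injF_bij[g' _ g'K] : injective g by move=> u v e; rewrite -(gK u) e gK.
case: x0; rewrite -(g'K x) -(g'K 0%R); congr g.
by rewrite -(gK (g' x)) -(gK (g' 0%R)) !g'K xx addr0.
Qed.

Lemma odd_modn_even d t : ~~ odd d -> odd (t %% d) = odd t.
Proof.
by move=> ev; rewrite [in RHS](divn_eq t d) oddD oddM (negbTE ev) andbF.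
Qed.

(** * Alternating label sequences *)

Section Zigzag.
Variables (V : zmodType) (beta c : V).
Local Open Scope ring_scope.

Definition zigzag (a : V) (t : nat) : V :=
  if odd t then c - a - beta *+ t./2 else a + beta *+ t./2.

Lemma zigzagS a t : zigzag a t + zigzag a t.+1 = c + beta *+ odd t.
Proof.
rewrite /zigzag oddS -uphalfE uphalf_half; case: odd => /=.
  by rewrite mulrS addrACA [- _ + _]addrCA addNr addr0 subrK.
by rewrite add0n addr0 addrC -[c - a - _]addrA -opprD subrK.
Qed.

(** Reduction modulo [h.*2] keeps the parity of [t] and changes its half by a multiple of [h], which
    [beta] annihilates. *)
Lemma zigzag_modn h a t : beta *+ h = 0 -> zigzag a (t %% h.*2) = zigzag a t.
Proof.
move=> bh; rewrite /zigzag odd_modn_even ?odd_double //.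
suff -> : beta *+ (t %% h.*2)./2 = beta *+ t./2 by [].
rewrite [in RHS](divn_eq t h.*2) -doubleMr halfD odd_double add0n doubleK.
by rewrite mulrnDr mulnC mulrnA bh mul0rn add0r.
Qed.
End Zigzag.

(** * Diagonal coordinates on the torus *)

Lemma eqn_mod_lcm m n x y :
  (x == y %[mod lcmn m n]) = (x == y %[mod m]) && (x == y %[mod n]).
Proof.
wlog le_yx : x y / y <= x.
  by move=> W; case: (leqP y x) => [/W//|/ltnW/W]; rewrite !(eq_sym (x %% _)).
by rewrite !eqn_mod_dvd // dvdn_lcm.
Qed.

Section Diagonals.
Variables (m n : nat) (m_gt0 : 0 < m) (n_gt0 : 0 < n).

Definition torus_shift (x : 'I_m * 'I_n) := (ordS x.1, ordS x.2).

Definition diag_point (k t : nat) : 'I_m * 'I_n :=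
  (Ordinal (ltn_pmod t m_gt0), Ordinal (ltn_pmod (t + k) n_gt0)).

Lemma diag_pointS k t : diag_point k t.+1 = torus_shift (diag_point k t).
Proof.
by congr pair; apply: val_inj; rewrite /= -[in RHS]addn1 modnDml addn1.
Qed.

Lemma diag_point_modn k t : diag_point k (t %% lcmn m n) = diag_point k t.
Proof.
congr pair; apply: val_inj => /=; first by rewrite modn_dvdm ?dvdn_lcml.
by rewrite -modnDml modn_dvdm ?dvdn_lcmr // modnDml.
Qed.

Definition diag_coord (p : 'I_(gcdn m n) * 'I_(lcmn m n)) :=
  diag_point p.1 p.2.

(** The cardinalities agree because lcm times gcd is [m * n]. For injectivity, the difference of the
    coordinates modulo the gcd recovers [k]; then [t] is known modulo [m] and modulo [n], hence
    modulo their lcm. *)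
Lemma diag_coord_bij : bijective diag_coord.
Proof.
apply: inj_card_bij; last by rewrite !card_prod !card_ord [leqRHS]mulnC muln_lcm_gcd.
move=> [k t] [k' t'] /= [et es].
have ek : k = k'.
  apply: val_inj => /=.
  rewrite -(modn_small (ltn_ord k)) -(modn_small (ltn_ord k')); apply/eqP.
  rewrite -(eqn_modDl t) -(modn_dvdm (t + k) (dvdn_gcdr m n)) es.
  rewrite modn_dvdm ?dvdn_gcdr // eqn_modDr.
  by rewrite -(modn_dvdm t (dvdn_gcdl m n)) et modn_dvdm ?dvdn_gcdl.
rewrite ek in es *; congr pair; apply: val_inj => /=.
rewrite -(modn_small (ltn_ord t)) -(modn_small (ltn_ord t')); apply/eqP.
by rewrite eqn_mod_lcm et eqxx -(eqn_modDr k') es /=.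
Qed.
End Diagonals.

(** Here [p] plays the quotient map by the multiples of [beta], and [s] the reflection that
    [v |-> c - v] induces on the quotient. *)
Lemma alternating_labeling (m n h : nat) (V : zmodType) (T : finType)
    (p : V -> T) (s : T -> T) (beta c : V) :
    0 < m -> 0 < n -> ~~ odd m -> lcmn m n = h.*2 -> #|T| = (gcdn m n).*2 ->
    (beta *+ h = 0)%R -> {in gtn h &, injective (GRing.natmul beta)} ->
    (forall x, exists v, p v = x) -> (forall v, p (v + beta)%R = p v) ->
    (forall v, p (c - v)%R = s (p v)) -> (forall x, s x <> x) ->
  exists f : 'I_m * 'I_n -> V, injective f /\
    forall x, (f x + f (torus_shift x) = c + beta *+ odd x.1)%R.
Proof.
move=> m_gt0 n_gt0 evm lcmE cardT bh b_inj p_onto p_b p_s s_fix.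
have sK : involutive s.
  by move=> x; have [v <-] := p_onto x; rewrite -!p_s opprB addrC subrK.
have [a [a_inj a_s]] := involution_transversal cardT sK s_fix.
have p_eqb x : exists v, p v == x by have [v <-] := p_onto x; exists v.
pose r k : V := xchoose (p_eqb (a k)).
have pr k : p (r k) = a k by apply/eqP/(xchooseP (p_eqb (a k))).
have p_bn v u : p (v + beta *+ u)%R = p v.
  by elim: u => [|u IH]; rewrite ?addr0 // mulrSr addrA p_b.
have p_bn' v u : p (v - beta *+ u)%R = p v by rewrite -(p_bn _ u) subrK.
have [q qK Kq] := diag_coord_bij m_gt0 n_gt0.
pose lab (kt : 'I_(gcdn m n) * 'I_(lcmn m n)) := zigzag beta c (r kt.1) kt.2.
(* Allowing unreduced [t] covers the step from the last vertex of an orbit back to its first. *)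
have lab_q (k : 'I_(gcdn m n)) t : lab (q (diag_point m_gt0 n_gt0 k t))
   = zigzag beta c (r k) t.
  have l_gt0 : 0 < lcmn m n by rewrite lcmn_gt0 m_gt0.
  pose t' := Ordinal (ltn_pmod t l_gt0).
  rewrite -diag_point_modn -/(diag_coord m_gt0 n_gt0 (k, t')) qK /lab /=.
  by rewrite lcmE zigzag_modn.
exists (fun x => lab (q x)); split; last first.
  move=> x; rewrite -(Kq x) /diag_coord; case: (q x) => k t /=.
  (* The first coordinate is [t] modulo the even number [m], so it has the parity of [t]. *)
  by rewrite -diag_pointS !lab_q zigzagS odd_modn_even.
apply: inj_comp (can_inj Kq) => -[k t] [k' t'].
rewrite /lab /zigzag /= => e.
have small (u : 'I_(lcmn m n)) : u./2 \in gtn h.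
  by rewrite inE ltn_half_double -lcmE.
(* Under [p] a label becomes [a k] at even times and [s (a k)] at odd ones, and these values are all
   distinct. *)
have ept : odd t = odd t' /\ k = k'.
  move/(congr1 p): e; case: (odd t); case: (odd t');
    rewrite ?p_bn ?p_bn' ?p_s !pr => e; split=> //.
  - by apply: a_inj; apply: (inv_inj sK).
  - by case: (a_s k' k).
  - by case: (a_s k' k).
  - by case: (a_s k k').
  - by case: (a_s k k').
  - exact: a_inj.
case: ept e => et ->; rewrite et => e; congr pair; apply: val_inj => /=.
rewrite -[LHS]odd_double_half -[RHS]odd_double_half et.
congr (_ + _.*2); apply: b_inj => //.
by case: odd e => [/addrI/oppr_inj|/addrI].
Qed.

(** * Neighbourhoods in the torus *)

Lemma cycle_nbhd k (hk : 3 <= k) (i : 'I_k) :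
  @open_nbhd (cycle_graph hk) i = [set ord_pred i; ordS i].
Proof.
apply/setP=> j; rewrite !inE /= /cycle_adj orbC; congr (_ || _).
by rewrite -[RHS](inj_eq (can_inj (@ordSK k))) ord_predK eq_sym.
Qed.

Lemma ordSS_neq k (hk : 3 <= k) (i : 'I_k) : ordS (ordS i) != i.
Proof.
rewrite -val_eqE /= -[X in X %% k]addn1 modnDml addn1 -addn2.
rewrite -{2}(modn_small (ltn_ord i)) -{2}[val i]addn0 eqn_modDl mod0n.
by rewrite modn_small.
Qed.

(** The four neighbours are grouped into pairs [x], [torus_shift x], to match the alternating
    sums. *)
Lemma torus_nbhd_sum m n (hm : 3 <= m) (hn : 3 <= n) (V : zmodType)
    (f : 'I_m * 'I_n -> V) (i : 'I_m) (j : 'I_n) :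
  (\sum_(u in @open_nbhd (cart_prod (cycle_graph hm) (cycle_graph hn)) (i, j))
      f u = (f (ord_pred i, j) + f (i, ordS j)) +
            (f (i, ord_pred j) + f (ordS i, j)))%R.
Proof.
have irrm (x : 'I_m) : (ordS x == x) = false.
  by have := cycle_adj_irr hm x; rewrite /cycle_adj orbb eq_sym.
have irrn (x : 'I_n) : (ordS x == x) = false.
  by have := cycle_adj_irr hn x; rewrite /cycle_adj orbb eq_sym.
have nm (x : 'I_m) : (ordS x == ord_pred x) = false.
  rewrite -(inj_eq (can_inj (@ordSK m))) ord_predK.
  exact/negbTE/ordSS_neq.
have nn (x : 'I_n) : (ordS x == ord_pred x) = false.
  rewrite -(inj_eq (can_inj (@ordSK n))) ord_predK.
  exact/negbTE/ordSS_neq.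
have pm (x : 'I_m) : (ord_pred x == x) = false.
  by rewrite -(inj_eq (can_inj (@ordSK m))) ord_predK eq_sym irrm.
have pn (x : 'I_n) : (ord_pred x == x) = false.
  by rewrite -(inj_eq (can_inj (@ordSK n))) ord_predK eq_sym irrn.
pose s := [:: (ord_pred i, j); (i, ordS j); (i, ord_pred j); (ordS i, j)].
have us : uniq s.
  rewrite /= !inE !xpair_eqE !eqxx ?[_ == ordS _]eq_sym ?[i == ord_pred i]eq_sym.
  by rewrite ?pm ?irrm ?irrn ?nm ?nn ?pn /= ?andbF.
transitivity (\sum_(u <- s) f u)%R; last first.
  by rewrite !big_cons big_nil addr0 !addrA.
rewrite big_uniq //; apply: eq_bigl => -[x y].
have := cycle_nbhd hm i => /setP/(_ x); have := cycle_nbhd hn j => /setP/(_ y).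
rewrite !inE /= => ey ex.
rewrite /cart_adj /= ey ex !xpair_eqE /= [i == x]eq_sym [j == y]eq_sym.
by case: (x == i); case: (y == j); case: (y == ordS j); case: (y == ord_pred j);
  case: (x == ordS i); case: (x == ord_pred i).
Qed.

(** Reduces the case of even [n] to that of even [m]. *)
Lemma cart_prod_swap (G H : sgraph) (V : zmodType) :
  has_distance_magic_labeling (cart_prod G H) V ->
  has_distance_magic_labeling (cart_prod H G) V.
Proof.
pose sw (S T : Type) (x : S * T) := (x.2, x.1).
have swK (S T : Type) : cancel (@sw S T) (@sw T S) by case.
move=> [f [bf [mu fmu]]]; exists (f \o @sw _ _); split.
  by apply: bij_comp bf _; exists (@sw _ _); apply: swK.
exists mu => v; rewrite -(fmu (sw _ _ v)).
rewrite (reindex (@sw _ _)) /=; last by exists (@sw _ _) => -[].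
by apply: eq_big => [x|[x y] //]; rewrite !inE /= /cart_adj orbC.
Qed.

Lemma odd_ord_pred m (x : 'I_m) : ~~ odd m -> odd (ord_pred x) = ~~ odd x.
Proof.
move=> ev; rewrite -[in RHS](ord_predK x); move: (ord_pred x) => y.
by rewrite /= odd_modn_even // oddS negbK.
Qed.

Lemma alternating_magic m n (hm : 3 <= m) (hn : 3 <= n) (V : zmodType)
    (c beta : V) (f : 'I_m * 'I_n -> V) :
    ~~ odd m -> bijective f ->
    (forall x, f x + f (torus_shift x) = c + beta *+ odd x.1)%R ->
  has_distance_magic_labeling (cart_prod (cycle_graph hm) (cycle_graph hn)) V.
Proof.
move=> evm bf fS; exists f; split=> //; exists (c + c + beta)%R => -[i j].
rewrite torus_nbhd_sum.
have -> : (f (ord_pred i, j) + f (i, ordS j) = c + beta *+ ~~ odd i)%R.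
  by have := fS (ord_pred i, j); rewrite /torus_shift ord_predK /= odd_ord_pred.
have -> : (f (i, ord_pred j) + f (ordS i, j) = c + beta *+ odd i)%R.
  by have := fS (i, ord_pred j); rewrite /torus_shift ord_predK.
by rewrite addrACA -mulrnDr; case: odd.
Qed.

(** * The quotient of the label group by a cyclic subgroup of order [h] *)

Section Quotient.
Variables (h q' : nat) (A : finZmodType).
Local Notation q := q'.+1.
Local Notation V := ('Z_(q * h) * A)%type.
Hypothesis qh_gt1 : 1 < q * h.
Local Open Scope ring_scope.

(** The target is ['I_q] because ['Z_q] would have two elements when [q = 1]. *)
Definition Zp_quo (x : 'Z_(q * h)) : 'I_q := inZp x.

Lemma dvdn_Zp_trunc : (q %| (Zp_trunc (q * h)).+2)%N.
Proof. by rewrite Zp_cast // dvdn_mulr. Qed.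

Lemma Zp_quoD x y : Zp_quo (x + y) = Zp_quo x + Zp_quo y.
Proof.
by apply: val_inj; rewrite /= modn_dvdm ?dvdn_Zp_trunc // modnDm.
Qed.

Lemma Zp_quoB x y : Zp_quo (x - y) = Zp_quo x - Zp_quo y.
Proof. by apply: (addIr (Zp_quo y)); rewrite -Zp_quoD !subrK. Qed.

Lemma Zp_quo_inZp (y : nat) : Zp_quo (inZp y) = inZp y.
Proof. by apply: val_inj; rewrite /= modn_dvdm ?dvdn_Zp_trunc. Qed.

(** The [beta] of the construction; its multiples form the kernel of [quo_map]. *)
Definition quo_gen : V := (inZp q, 0).

Lemma quo_gen_mul u : quo_gen *+ u = (inZp (q * u), 0).
Proof.
elim: u => [|u IH]; first by rewrite muln0; congr pair; apply: val_inj.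
rewrite mulrS IH; congr pair; last exact: addr0.
by apply: val_inj; rewrite /= modnDm mulnS.
Qed.

Lemma quo_gen_inj : {in gtn h &, injective (GRing.natmul quo_gen)}.
Proof.
move=> u v; rewrite !inE => uh vh; rewrite !quo_gen_mul => -[].
rewrite Zp_cast // !modn_small ?ltn_pmul2l // => /eqP.
by rewrite eqn_pmul2l // => /eqP.
Qed.

Definition quo_map (v : V) : 'I_q * A := (Zp_quo v.1, v.2).

(** One of the two factors has even order; [c] is chosen there, with 0 in the other coordinate. *)
Lemma quo_refl_fixfree : ~~ odd (q * #|A|) ->
  exists c : V, forall v, quo_map (c - v) <> quo_map v.
Proof.
rewrite oddM negb_and => /orP[ev|ev].
  have [|c fc] := @even_card_double_not_onto 'I_q; first by rewrite card_ord.
  exists (inZp c, 0) => v /(congr1 fst) e; apply: (fc (Zp_quo v.1)).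
  by rewrite -[c]valZpK -Zp_quo_inZp -Zp_quoB; apply: e.
have [c fc] := even_card_double_not_onto ev.
by exists (0, c) => v [_]; apply: fc.
Qed.
End Quotient.

(** * Assembling the labeling *)

Lemma even_torus_magic m n (hm : 3 <= m) (hn : 3 <= n) q h (A : finZmodType) :
    ~~ odd m -> lcmn m n = h.*2 -> 0 < q -> q * #|A| = (gcdn m n).*2 ->
  has_distance_magic_labeling (cart_prod (cycle_graph hm) (cycle_graph hn))
    ('Z_(q * h) * A)%type.
Proof.
move=> evm lE; case: q => // q _ cardQ.
have m_gt0 : 0 < m by apply: leq_trans hm.
have n_gt0 : 0 < n by apply: leq_trans hn.
(* This makes [q.+1 * h] at least 2, so that ['Z_(q.+1 * h)] really has [q.+1 * h] elements. *)
have h_gt1 : 1 < h.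
  have : 3 <= lcmn m n.
    by apply: leq_trans hm _; rewrite dvdn_leq ?dvdn_lcml // lcmn_gt0 m_gt0.
  by rewrite lE; case: h {lE} => [|[|h]].
have qh_gt1 : 1 < q.+1 * h by apply: leq_trans h_gt1 _; rewrite leq_pmull.
have [|c fc] := @quo_refl_fixfree h q A qh_gt1.
  by rewrite cardQ odd_double.
pose p := @quo_map h q A.
have p_onto x : exists v, p v = x.
  case: x => y a; exists (inZp y, a).
  by rewrite /p /quo_map /= Zp_quo_inZp // valZpK.
have [f [f_inj fS]] : exists f : 'I_m * 'I_n -> ('Z_(q.+1 * h) * A)%type,
    injective f /\ forall x,
      (f x + f (torus_shift x) = c + quo_gen h q A *+ odd x.1)%R.
  apply: (@alternating_labeling m n h _ _ p
           (fun x => ((p c).1 - x.1, (p c).2 - x.2)%R)) => //.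
  - by rewrite card_prod card_ord.
  - rewrite quo_gen_mul //; congr pair; apply: val_inj.
    by rewrite /= Zp_cast // modnn.
  - exact: quo_gen_inj.
  - move=> v; congr pair; last exact: addr0.
    rewrite Zp_quoD // /quo_gen Zp_quo_inZp //.
    by apply: val_inj; rewrite /= modnn addn0 modn_mod.
  - by move=> v; congr pair; rewrite Zp_quoB.
  - move=> x; have [v <-] := p_onto x => e; apply: (fc v).
    by rewrite -[RHS]e; congr pair; rewrite Zp_quoB.
apply: alternating_magic evm _ fS.
apply: inj_card_bij f_inj _.
rewrite !card_prod !card_ord Zp_cast // mulnAC cardQ -(muln_lcm_gcd m n) lE.
by rewrite -!doubleMl mulnC.
Qed.

Theorem theorem2p3 (m n : nat) (hm : 3 <= m) (hn : 3 <= n)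
    (hmn : ~~ odd (m * n)) (alpha : nat) (halpha : 0 < alpha)
    (hdvd : alpha %| m * n) (hmod : alpha = 0 %[mod lcmn m n %/ 2])
    (A : finZmodType) (hA : #|A| = (m * n) %/ alpha) :
  has_distance_magic_labeling (cart_prod (cycle_graph hm) (cycle_graph hn))
    ('Z_alpha * A)%type.
Proof.
have [h lE] : exists h, lcmn m n = h.*2.
  exists (lcmn m n)./2; rewrite -[LHS]odd_double_half.
  suff /negbTE -> : ~~ odd (lcmn m n) by [].
  move: hmn; rewrite -!dvdn2 Euclid_dvdM // => /orP[e|e].
    exact: dvdn_trans e (dvdn_lcml m n).
  exact: dvdn_trans e (dvdn_lcmr m n).
have /dvdnP[q aE] : h %| alpha.
  by move: hmod; rewrite lE divn2 doubleK mod0n => /eqP.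
move: halpha; rewrite aE muln_gt0 => /andP[q_gt0 h_gt0].
(* After multiplication by [h] both sides equal [m * n]: the left one is [alpha * #|A|], the right
   one gcd times lcm. *)
have cardQ : q * #|A| = (gcdn m n).*2.
  apply/eqP; rewrite -(eqn_pmul2l h_gt0) mulnA [h * q]mulnC -aE hA.
  by rewrite mulnC divnK // -muln_lcm_gcd lE -doubleMl -doubleMr.
move: hmn; rewrite oddM negb_and => /orP[ev|ev].
  exact: even_torus_magic.
apply: cart_prod_swap; apply: even_torus_magic => //.
  by rewrite lcmnC.
by rewrite gcdnC.
Qed.
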